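(* Let $0<\varepsilon<1$, let $n\ge1$ and $m\ge1$ be integers, let $A=(a_{pq})$ be a real $n\times n$ matrix and $j\in\{1,\dots,n\}$ with $a_{1j}>0$. Suppose $\lambda>0$ is a simple eigenvalue of $A$ with $A\mathbf u=\lambda\mathbf u$ and $\mathbf v^TA=\lambda\mathbf v^T$ for some entrywise positive $\mathbf u,\mathbf v\in\mathbb R^n$. Let $k\in\{1,\dots,n\}$ be such that $c:=a_{1j}v_1+\sum_{i=1}^{n-k}a_{k+i,j}v_{k+i}>0$ (for $k=n$ this means $a_{1j}>0$). Let $E=\{(m+1,m+j)\}\cup\{(m+k+1,m+j),\dots,(m+n,m+j)\}$. In each part $B=(b_{pq})$ is a real matrix of order $m+n$ whose entries with $p,q\in\{m+1,\dots,m+n\}$ and $(p,q)\notin E$ equal $a_{p-m,q-m}$; in all parts $w_i=u_j$ for $1\le i\le m$, $w_i=u_{i-m}$ and $z_i=v_{i-m}$ for $m+1\le i\le m+n$. Then: 1. For every $s\in\{1,\dots,m\}$, let the remaining entries of $B$ be: $\lambda$ at the positions $(m,m+j),(1,2),(2,3),\dots,(m-1,m)$; $a_{1j}$ at $(m+1,1)$; $a_{p-m,j}$ at $(p,s)$ for $p\in\{m+k+1,\dots,m+n\}$; $0$ elsewhere. Then $\lambda$ is a simple eigenvalue of $B$, $B\mathbf w=\lambda\mathbf w$ and $\mathbf z^TB=\lambda\mathbf z^T$ where $z_i=\frac{a_{1j}v_1}{\lambda}$ for $1\le i\le s-1$ and $z_i=\frac{c}{\lambda}$ for $s\le i\le m$;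 consequently $B$ is algebraically positive. 2. For every $s\in\{1,\dots,m-1\}$ and $t\in\{1,\dots,m\}\setminus\{s+1\}$, let the remaining entries of $B$ be: $\lambda$ at the positions in $(\{(m,m+j)\}\cup\{(1,2),\dots,(m-1,m)\})\setminus\{(s,s+1)\}$; $\varepsilon\lambda$ at $(s,s+1)$; $a_{1j}$ at $(m+1,1)$; $(1-\varepsilon)\lambda$ at $(s,t)$; $a_{p-m,j}$ at $(p,t)$ for $p\in\{m+k+1,\dots,m+n\}$; $0$ elsewhere. Then $\lambda$ is a simple eigenvalue of $B$ with $B\mathbf w=\lambda\mathbf w$, $\mathbf z^TB=\lambda\mathbf z^T$, and $B$ is algebraically positive, where: if $t\le s$, $z_i=\frac{a_{1j}v_1}{\lambda}$ for $1\le i\le t-1$, $z_i=\frac{c}{\varepsilon\lambda}$ for $t\le i\le s$, $z_i=\frac{c}{\lambda}$ for $s+1\le i\le m$; if $t\ge s+2$, $z_i=\frac{a_{1j}v_1}{\lambda}$ for $1\le i\le s$, $z_i=\frac{\varepsilon a_{1j}v_1}{\lambda}$ for $s+1\le i\le t-1$, $z_i=\frac{c}{\lambda}$ for $t\le i\le m$. Further, $b_{st}z_s+\sum_{i=1}^{n-k}b_{m+k+i,t}z_{m+k+i}$ equals $\frac{c}{\varepsilon}-a_{1j}v_1$ if $t\le s$ and equals $c-\varepsilon a_{1j}v_1$ if $t\ge s+2$, and this quantity is positive for a suitable choice of $\varepsilon\in(0,1)$. 3. For every $t\in\{1,\dots,m\}$, let the remaining entries of $B$ be: $\lambda$ at $(1,2),\dots,(m-1,m)$;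 $\varepsilon\lambda$ at $(m,m+j)$; $a_{1j}$ at $(m+1,1)$; $(1-\varepsilon)\lambda$ at $(m,t)$; $a_{p-m,j}$ at $(p,t)$ for $p\in\{m+k+1,\dots,m+n\}$; $0$ elsewhere. Then $\lambda$ is a simple eigenvalue of $B$, $B\mathbf w=\lambda\mathbf w$ and $\mathbf z^TB=\lambda\mathbf z^T$ where $z_i=\frac{a_{1j}v_1}{\lambda}$ for $1\le i\le t-1$ and $z_i=\frac{c}{\varepsilon\lambda}$ for $t\le i\le m$; consequently $B$ is algebraically positive. Further, $b_{mt}z_m+\sum_{i=1}^{n-k}b_{m+k+i,t}z_{m+k+i}=\frac{c}{\varepsilon}-a_{1j}v_1$, and this is positive for a suitable choice of $\varepsilon\in(0,1)$.
   Context: A real square matrix $M$ is algebraically positive if there is a real polynomial $f$ such that every entry of $f(M)$ is positive. A simple eigenvalue is one of algebraic multiplicity one. Index ranges of the form $a\le i\le b$ with $a>b$ are empty. *)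

(* Defs.v *)
From HB Require Import structures.
From mathcomp Require Import all_boot all_order all_algebra.
From mathcomp Require Import reals.
Set Implicit Arguments. Unset Strict Implicit. Unset Printing Implicit Defensive.
Import Order.TTheory GRing.Theory Num.Theory.
Local Open Scope ring_scope.

Section Defs.
Variable R : realType.

(* 1-based entry access: ent M p q = M_{pq} (p,q >= 1); 0 outside the range. *)
Definition ent (r c : nat) (M : 'M[R]_(r, c)) (p q : nat) : R :=
  if (0 < p)%N && (0 < q)%N then
    match (insub p.-1 : option 'I_r), (insub q.-1 : option 'I_c) with
    | Some i, Some j => M i j
    | _, _ => 0
    end
  else 0.

Definition mx_of (N : nat) (f : nat -> nat -> R) : 'M[R]_N :=
  \matrix_(p < N, q < N) f p.+1 q.+1.
Definition cv_of (N : nat) (f : nat -> R) : 'cV[R]_N := \col_(p < N) f p.+1.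

Definition simple_eigenvalue (N : nat) (lam : R) (M : 'M[R]_N) : Prop :=
  mup lam (char_poly M) = 1%N.

Definition alg_positive (N : nat) (M : 'M[R]_N) : Prop :=
  exists f : {poly R}, forall i j : 'I_N,
    0 < (\sum_(d < size f) f`_d *: M ^+ d) i j.

Definition cval (n : nat) (A : 'M[R]_n) (v : 'cV[R]_n) (j k : nat) : R :=
  ent A 1 j * ent v 1 1 +
  \sum_(1 <= i < (n - k).+1) ent A (k + i) j * ent v (k + i) 1.

Definition inE (m n j k p q : nat) : bool :=
  (q == m + j) && ((p == m.+1) || ((m + k < p)%N && (p <= m + n)%N)).

Definition lowA (n : nat) (A : 'M[R]_n) (m j k p q : nat) : R :=
  if ~~ inE m n j k p q then ent A (p - m) (q - m) else 0.

Definition chain (m p q : nat) : bool := (0 < p)%N && (p < m)%N && (q == p.+1).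

Definition lowcol (m n k p : nat) : bool := (m + k < p)%N && (p <= m + n)%N.

Definition B1f (n : nat) (A : 'M[R]_n) (m j k : nat) (lam : R) (s : nat)
  (p q : nat) : R :=
  if (m < p)%N && (m < q)%N then lowA A m j k p q
  else if (p == m) && (q == m + j) then lam
  else if chain m p q then lam
  else if (p == m.+1) && (q == 1%N) then ent A 1 j
  else if lowcol m n k p && (q == s) then ent A (p - m) j
  else 0.

Definition B2f (n : nat) (A : 'M[R]_n) (m j k : nat) (lam eps : R) (s t : nat)
  (p q : nat) : R :=
  if (m < p)%N && (m < q)%N then lowA A m j k p q
  else if (p == m) && (q == m + j) then lam
  else if (p == s) && (q == s.+1) then eps * lam
  else if chain m p q then lam
  else if (p == m.+1) && (q == 1%N) then ent A 1 j
  else if (p == s) && (q == t) then (1 - eps) * lam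
  else if lowcol m n k p && (q == t) then ent A (p - m) j
  else 0.

Definition B3f (n : nat) (A : 'M[R]_n) (m j k : nat) (lam eps : R) (t : nat)
  (p q : nat) : R :=
  if (m < p)%N && (m < q)%N then lowA A m j k p q
  else if chain m p q then lam
  else if (p == m) && (q == m + j) then eps * lam
  else if (p == m.+1) && (q == 1%N) then ent A 1 j
  else if (p == m) && (q == t) then (1 - eps) * lam
  else if lowcol m n k p && (q == t) then ent A (p - m) j
  else 0.

Definition wvec (n : nat) (u : 'cV[R]_n) (m j : nat) : 'cV[R]_(m + n) :=
  cv_of (m + n) (fun i => if (i <= m)%N then ent u j 1 else ent u (i - m) 1).

Definition zvec (n : nat) (v : 'cV[R]_n) (m : nat) (low : nat -> R)
  : 'cV[R]_(m + n) :=
  cv_of (m + n) (fun i => if (i <= m)%N then low i else ent v (i - m) 1).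

Definition z1low (n : nat) (A : 'M[R]_n) (v : 'cV[R]_n) (j k : nat) (lam : R)
  (s i : nat) : R :=
  if (i < s)%N then ent A 1 j * ent v 1 1 / lam else cval A v j k / lam.

Definition z2low (n : nat) (A : 'M[R]_n) (v : 'cV[R]_n) (j k : nat) (lam eps : R)
  (s t i : nat) : R :=
  if (t <= s)%N then
    (if (i < t)%N then ent A 1 j * ent v 1 1 / lam
     else if (i <= s)%N then cval A v j k / (eps * lam)
     else cval A v j k / lam)
  else
    (if (i <= s)%N then ent A 1 j * ent v 1 1 / lam
     else if (i < t)%N then eps * (ent A 1 j * ent v 1 1) / lam
     else cval A v j k / lam).

Definition z3low (n : nat) (A : 'M[R]_n) (v : 'cV[R]_n) (j k : nat) (lam eps : R)
  (t i : nat) : R :=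
  if (i < t)%N then ent A 1 j * ent v 1 1 / lam else cval A v j k / (eps * lam).

Definition qty (N : nat) (B : 'M[R]_N) (z : 'cV[R]_N) (m n k r t : nat) : R :=
  ent B r t * ent z r 1 +
  \sum_(1 <= i < (n - k).+1) ent B (m + k + i) t * ent z (m + k + i) 1.

End Defs.

(* Main.v *)
(* If [M w = lam w], [z M = lam z] and [z w = 1], the deflated matrix
   [M0 = M - lam w z] satisfies [X * char M = (X - lam) * char M0]. So [lam] is
   simple iff it is not an eigenvalue of [M0], i.e. iff no nonzero [y] satisfies
   [M y = lam y] and [z y = 0]; and then [char M0] evaluated at [M] is a nonzero
   multiple of [w z], which is positive when [w] and [z] are. With the positive
   pair [w], [z], simplicity for [B] thus reduces to the one-dimensionality of
   [ker (B - lam)], which follows from that of [ker (A - lam)] because the first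
   [m] rows force an eigenvector to be constant along the new path. *)

Require Import Defs.
From HB Require Import structures.
From mathcomp Require Import all_boot all_order all_algebra.
From mathcomp Require Import reals.
From mathcomp Require Import ring lra zify.
Import Order.TTheory GRing.Theory Num.Theory.
Local Open Scope ring_scope.

Set Implicit Arguments.
Unset Strict Implicit.

(** * Deflation of a simple eigenvalue *)

(** Multiplying [D] on the right by two block triangular matrices exposes its two Schur complements,
    a + w z and, up to the factor a, a + z w; the determinants are then compared. Keeping a as a
    factor avoids division: the lemma is applied to the non-unit X - lam. *)
Lemma det_scalar_add_rank1 (R : comPzRingType) (N : nat) (a : R) (w : 'cV[R]_N) (z : 'rV[R]_N) :
  a * \det (a%:M + w *m z) = (a + (z *m w) 0 0) * a ^+ N.
Proof.
set D := block_mx (1%:M : 'M_1) (- z) w (a%:M).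
have e1 : D *m block_mx 1%:M z 0 1%:M = block_mx 1%:M 0 w (a%:M + w *m z).
  by rewrite mulmx_block !mulmx0 !addr0 !mulmx1 mul1mx subrr addrC.
have e2 : D *m block_mx a%:M 0 (- w) 1%:M
   = block_mx ((a + (z *m w) 0 0)%:M) (- z) 0 a%:M.
  rewrite mulmx_block !mulmx0 !add0r !mulmx1 mul1mx mulNmx mulmxN opprK.
  rewrite mul_mx_scalar mulmxN mul_scalar_mx subrr.
  by rewrite raddfD /= -mx11_scalar.
have := congr1 determinant e1; have := congr1 determinant e2.
rewrite !det_mulmx det_ublock (@det_lblock _ 1 N a%:M) (@det_ublock _ 1 N 1%:M).
rewrite (@det_lblock _ 1 N 1%:M) !det1 !mulr1 !mul1r !det_scalar !expr1.
by move=> e3 <-; rewrite mulrC.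
Qed.

Section Deflation.
Variables (R : fieldType) (N : nat) (lam : R) (M : 'M[R]_N) (w : 'cV[R]_N) (z : 'rV[R]_N).
Hypotheses (lam0 : lam != 0) (Mw : M *m w = lam *: w) (zM : z *m M = lam *: z).
Hypothesis zw : z *m w = 1%:M.

(** Put a = X - lam. Since (X - M) w = a w, the product (X - M)(a + lam w z) equals a (X - M0) with
    M0 the deflated matrix. Taking determinants, the rank-one factor contributes a + lam = X, and a
    power of a cancels. *)
Lemma char_poly_deflate :
  'X * char_poly M = ('X - lam%:P) * char_poly (M - lam *: (w *m z)).
Proof.
set a : {poly R} := 'X - lam%:P.
have a0 : a != 0 by rewrite polyXsubC_eq0.
have e : char_poly_mx M *m (a%:M + (lam%:P *: map_mx polyC w) *m map_mx polyC z)
       = a *: char_poly_mx (M - lam *: (w *m z)).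
  have cw : char_poly_mx M *m map_mx polyC w = a *: map_mx polyC w.
    by rewrite /char_poly_mx mulmxBl -map_mxM Mw map_mxZ mul_scalar_mx scalerBl.
  rewrite mulmxDr mulmxA mul_mx_scalar -scalemxAr cw.
  rewrite /char_poly_mx map_mxB map_mxZ map_mxM opprB -!scalemxAl scalerA.
  by rewrite [lam%:P * a]mulrC -scalerA -scalerDr -addrA [X in _ + X]addrC.
have := congr1 determinant e; rewrite det_mulmx detZ => /(congr1 ( *%R a)).
rewrite mulrCA det_scalar_add_rank1 -scalemxAr -map_mxM zw !mxE /= mulr1 subrK.
rewrite [X in _ = X -> _]mulrCA => h; apply: (mulfI (expf_neq0 N a0)).
by rewrite -h /char_poly; ring.
Qed.

(** As lam is nonzero, the factor X does not affect the multiplicity at lam. *)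
Lemma mup_char_poly_deflate :
  mup lam (char_poly M) = (mup lam (char_poly (M - lam *: (w *m z)))).+1.
Proof.
rewrite -(@mupMr _ lam 'X); last by rewrite rootE hornerX.
rewrite char_poly_deflate mupM ?polyXsubC_eq0 ?monic_neq0 ?char_poly_monic //.
by rewrite -['X - _]expr1 mup_XsubCX eqxx.
Qed.

Lemma deflate_left : z *m (M - lam *: (w *m z)) = 0.
Proof. by rewrite mulmxBr zM -scalemxAr mulmxA zw mul1mx subrr. Qed.

Lemma simple_root_deflate :
  (mup lam (char_poly M) == 1%N) = ~~ root (char_poly (M - lam *: (w *m z))) lam.
Proof.
rewrite mup_char_poly_deflate eqSS -dvdp_XsubCl XsubC_dvd -?eqn0Ngt //.
by rewrite monic_neq0 ?char_poly_monic.
Qed.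

(** From z M0 = 0 and lam nonzero, every y with M0 y = lam y satisfies z y = 0, and M and M0 agree
    on the kernel of z. *)
Lemma simple_root_char_polyP :
  (mup lam (char_poly M) = 1%N) <->
  (forall y : 'cV[R]_N, M *m y = lam *: y -> z *m y = 0 -> y = 0).
Proof.
(* The transpose makes [det0P], which speaks of row vectors, deliver column eigenvectors. *)
have rootP : root (char_poly (M - lam *: (w *m z))) lam =
             (\det (lam%:M - (M - lam *: (w *m z)))^T == 0).
  rewrite det_tr -eigenvalue_root_char; apply/eigenvalueP/det0P.
    case=> v e v0; exists v => //.
    by rewrite mulmxBr e mul_mx_scalar subrr.
  case=> v v0 e; exists v => //; move/eqP: e.
  by rewrite mulmxBr mul_mx_scalar subr_eq0 => /eqP.
split=> [/eqP | H].
  rewrite simple_root_deflate rootP => /det0P nd y My zy; apply/eqP/contraT => y0.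
  case: nd; exists y^T; first by rewrite trmx_eq0.
  rewrite -trmx_mul !mulmxBl My -scalemxAl -mulmxA zy mulmx0 scaler0 subr0.
  by rewrite mul_scalar_mx subrr trmx0.
apply/eqP; rewrite simple_root_deflate rootP; apply/det0P => -[v v0 e].
have e' : (M - lam *: (w *m z)) *m v^T = lam *: v^T.
  apply/esym/eqP; rewrite -subr_eq0 -mul_scalar_mx -mulmxBl.
  by rewrite -[_ *m _]trmxK trmx_mul trmxK e trmx0.
have zy : z *m v^T = 0.
  have := congr1 (mulmx z) e'; rewrite mulmxA deflate_left mul0mx -scalemxAr.
  by move/esym/eqP; rewrite scaler_eq0 (negPf lam0) => /eqP.
have /H/(_ zy) : M *m v^T = lam *: v^T.
  by rewrite -e' mulmxBl -scalemxAl -mulmxA zy mulmx0 scaler0 subr0.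
by move/eqP; rewrite trmx_eq0 (negPf v0).
Qed.

End Deflation.

Lemma horner_mxE (R : comNzRingType) (N : nat) (M : 'M[R]_N.+1) (p : {poly R}) :
  horner_mx M p = \sum_(d < size p) p`_d *: M ^+ d.
Proof.
rewrite -[in LHS](coefK p) poly_def raddf_sum /=; apply: eq_bigr => d _.
by rewrite linearZ /= rmorphXn /= horner_mx_X.
Qed.

(* [p(M) - p(M0)] is the rank-one matrix [(p(lam) - p(0)) w z]; for [p] the
   characteristic polynomial of [M0] both [p(M0)] and [p(0)] vanish. *)
Lemma simple_root_projection (R : fieldType) (N : nat) (lam : R) (M : 'M[R]_N)
    (w : 'cV[R]_N) (z : 'rV[R]_N) :
  lam != 0 -> M *m w = lam *: w -> z *m M = lam *: z -> z *m w = 1%:M ->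
  mup lam (char_poly M) = 1%N ->
  exists f : {poly R}, \sum_(d < size f) f`_d *: M ^+ d = w *m z.
Proof.
(* [horner_mxE] is stated for a successor order, so the trivial order 0 is split off. *)
case: N M w z => [|N] M w z; first by exists 0; rewrite [LHS]flatmx0 [RHS]flatmx0.
move=> lam0 Mw zM zw /eqP; rewrite (simple_root_deflate lam0 Mw zw).
set M0 := M - _; set g := char_poly M0 => gl.
have zM0 : z *m M0 = 0 by exact: deflate_left.
have Mp p : horner_mx M p *m w = p.[lam] *: w.
  elim/poly_ind: p => [|p c IH]; first by rewrite raddf0 mul0mx horner0 scale0r.
  rewrite raddfD /= rmorphM /= horner_mx_X horner_mx_C mulmxDl -mulmxA Mw.
  by rewrite -scalemxAr IH scalerA mul_scalar_mx -scalerDl hornerMXaddC mulrC.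
have MM0 p : horner_mx M p = horner_mx M0 p + (p.[lam] - p.[0]) *: (w *m z).
  elim/poly_ind: p => [|p c IH]; first by rewrite !raddf0 !horner0 subr0 scale0r addr0.
  rewrite !raddfD /= !rmorphM /= !horner_mx_X !horner_mx_C !hornerMXaddC.
  rewrite mulr0 add0r addrK -(subrK (lam *: (w *m z)) M) -/M0 mulrDr subrK.
  rewrite {1}IH mulrDl -scalerAl -[w *m z * M0]mulmxA zM0 mulmx0 scaler0 addr0.
  by rewrite -scalerAr [_ * (w *m z)]mulmxA Mp -scalemxAl scalerA [lam * _]mulrC addrAC.
(* The vector z is nonzero because z w = 1, and z M0 = 0, so 0 is an eigenvalue of M0. *)
have g0 : g.[0] = 0.
  apply/eqP; rewrite -/(root _ _) -eigenvalue_root_char; apply/eigenvalueP.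
  exists z; first by rewrite zM0 scale0r.
  by apply: contra_eq_neq zw => ->; rewrite mul0mx eq_sym oner_neq0.
(* Simplicity ([gl]) makes g(lam) nonzero; dividing by it turns the coefficient of w z into 1. *)
exists (g.[lam]^-1 *: g).
by rewrite -horner_mxE linearZ /= MM0 Cayley_Hamilton add0r g0 subr0 scalerA mulVf // scale1r.
Qed.

Lemma pairing_gt0 (R : realFieldType) (N : nat) (w z : 'cV[R]_N) : (0 < N)%N ->
  (forall i, 0 < w i 0) -> (forall i, 0 < z i 0) -> 0 < (z^T *m w) 0 0.
Proof.
move=> N0 wpos zpos; rewrite mxE; under eq_bigr do rewrite mxE.
rewrite (bigD1 (Ordinal N0)) //= ltr_pwDl ?mulr_gt0 //.
by apply: sumr_ge0 => i _; rewrite ltW // mulr_gt0.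
Qed.

(** * Positive eigenvectors and algebraic positivity *)

Section EigenPositive.
Variables (R : realType) (N : nat) (lam : R) (M : 'M[R]_N) (w z : 'cV[R]_N).
Hypotheses (N0 : (0 < N)%N) (lam0 : lam != 0).
Hypotheses (Mw : M *m w = lam *: w) (zM : z^T *m M = lam *: z^T).
Hypotheses (wpos : forall i, 0 < w i 0) (zpos : forall i, 0 < z i 0).

(** Rescaling [w] by this positive number gives the normalisation z w = 1 that deflation requires
    and keeps the entries positive. *)
Let a := (z^T *m w) 0 0.
Let w1 := a^-1 *: w.

Let Mw1 : M *m w1 = lam *: w1.
Proof. by rewrite -scalemxAr Mw !scalerA mulrC. Qed.

Let zw1 : z^T *m w1 = 1%:M.
Proof.
by rewrite -scalemxAr [_ *m w]mx11_scalar scale_scalar_mx mulVf // gt_eqF ?pairing_gt0.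
Qed.

Lemma pos_simple_eigenvalueP : simple_eigenvalue lam M <->
  (forall y : 'cV[R]_N, M *m y = lam *: y -> z^T *m y = 0 -> y = 0).
Proof. exact: (simple_root_char_polyP lam0 Mw1 zM zw1). Qed.

Lemma simple_alg_positive : simple_eigenvalue lam M -> alg_positive M.
Proof.
move=> sM; have [f fE] := simple_root_projection lam0 Mw1 zM zw1 sM.
by exists f => i j; rewrite fE mxE big_ord1 !mxE !mulr_gt0 ?invr_gt0 ?pairing_gt0.
Qed.

End EigenPositive.

(** * Entrywise description of matrices and vectors *)

Section EntryAccess.
Variable R : realType.

Lemma entE (r c : nat) (M : 'M[R]_(r, c)) (p : 'I_r) (q : 'I_c) : ent M p.+1 q.+1 = M p q.
Proof. by rewrite /ent /= !valK. Qed.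

Lemma ent_mx_of (N p q : nat) (f : nat -> nat -> R) :
  (0 < p <= N)%N -> (0 < q <= N)%N -> ent (mx_of N f) p q = f p q.
Proof.
case: p q => [|p] [|q] //= hp hq.
by rewrite (entE _ (Ordinal hp) (Ordinal hq)) mxE.
Qed.

Lemma ent_cv_of (N p : nat) (f : nat -> R) : (0 < p <= N)%N -> ent (cv_of N f) p 1 = f p.
Proof. by case: p => [|p] //= hp; rewrite (entE _ (Ordinal hp) ord0) mxE. Qed.

Lemma mx_of_ent (N : nat) (M : 'M[R]_N) : mx_of N (ent M) = M.
Proof. by apply/matrixP => p q; rewrite mxE entE. Qed.

Lemma cv_of_ent (N : nat) (y : 'cV[R]_N) : cv_of N (fun p => ent y p 1) = y.
Proof. by apply/matrixP => p q; rewrite mxE (ord1 q) (entE _ p ord0). Qed.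

Lemma eq_mx_of (N : nat) (f g : nat -> nat -> R) :
  (forall p q, (0 < p <= N)%N -> (0 < q <= N)%N -> f p q = g p q) -> mx_of N f = mx_of N g.
Proof. by move=> fg; apply/matrixP => p q; rewrite !mxE fg //=. Qed.

Lemma cv_ofP (N : nat) (f g : nat -> R) :
  (forall p, (0 < p <= N)%N -> f p = g p) <-> cv_of N f = cv_of N g.
Proof.
split=> [fg | fg p hp]; last by rewrite -(ent_cv_of f hp) fg ent_cv_of.
by apply/matrixP => p q; rewrite !mxE fg /=.
Qed.

Lemma mul_mx_cv_of (N : nat) (f : nat -> nat -> R) (y : nat -> R) :
  mx_of N f *m cv_of N y = cv_of N (fun p => \sum_(1 <= q < N.+1) f p q * y q).
Proof.
apply/matrixP => p q; rewrite !mxE big_add1 big_mkord.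
by apply: eq_bigr => i _; rewrite !mxE.
Qed.

Lemma mul_cv_mx_of (N : nat) (f : nat -> nat -> R) (y : nat -> R) :
  (cv_of N y)^T *m mx_of N f = (cv_of N (fun q => \sum_(1 <= p < N.+1) y p * f p q))^T.
Proof.
apply/matrixP => p q; rewrite !mxE big_add1 big_mkord.
by apply: eq_bigr => i _; rewrite !mxE.
Qed.

Lemma scale_cv_of (N : nat) (a : R) (y : nat -> R) :
  a *: cv_of N y = cv_of N (fun p => a * y p).
Proof. by apply/matrixP => p q; rewrite !mxE. Qed.

Lemma sum_delta (a b c : nat) (F : nat -> R) : (a <= c < b)%N ->
  \sum_(a <= q < b) (q == c)%:R * F q = F c.
Proof.
move=> h; have -> : F c = if (a <= c < b)%N then F c else 0 by rewrite h.
rewrite -(big_nat1_eq +%R F) big_mkcond /=; apply: eq_bigr => q _.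
by case: eqP; rewrite ?mul1r ?mul0r.
Qed.

Lemma sum_shift (a b : nat) (F : nat -> R) :
  \sum_(1 <= i < (a + b).+1) F i
  = \sum_(1 <= i < a.+1) F i + \sum_(1 <= i < b.+1) F (a + i)%N.
Proof.
rewrite (@big_cat_nat _ _ _ a.+1) //= ?ltnS ?leq_addr //.
congr (_ + _); rewrite -[a.+1]add1n big_addn.
rewrite (_ : ((a + b).+1 - a)%N = b.+1); last by lia.
by apply: eq_bigr => i _; rewrite addnC.
Qed.

(** Brings the shifted sums of [cval] and [qty] into the indicator form in which the columns of [Bf]
    produce them. *)
Lemma sum_tail (k n : nat) (F : nat -> R) : (k <= n)%N ->
  \sum_(1 <= i < (n - k).+1) F (k + i)%N = \sum_(1 <= i < n.+1) (k < i)%:R * F i.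
Proof.
move=> kn; rewrite -[X in \sum_(1 <= i < X.+1) _ * _](subnKC kn) sum_shift.
rewrite (_ : \sum_(1 <= i < k.+1) (k < i)%:R * F i = 0) ?add0r; last first.
  by rewrite big_nat big1 // => i /andP[_ ik]; rewrite ltnNge -ltnS ik mul0r.
apply: eq_big_nat => i /andP[i1 _].
by rewrite -[X in (X < _)%N]addn0 ltn_add2l i1 mul1r.
Qed.

End EntryAccess.

(** * The bordered matrices *)

Section Border.
Variables (R : realType) (n m : nat) (A : 'M[R]_n) (j k : nat) (lam : R).

(** Successor along the path 1, 2, ..., m, m + j, whose edges all have weight [lam] except the split
    one. *)
Definition next (p : nat) : nat := if (p < m)%N then p.+1 else (m + j)%N.

(* For [e = 1] the weight at [(s, t)] vanishes, which is the matrix of part 1;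
   for [s = m] the split edge is [(m, m + j)], which is part 3. *)
Definition Bf (e : R) (s t p q : nat) : R :=
  if (p <= m)%N then
    lam * ((if p == s then e else 1) * (q == next p)%:R
           + (p == s)%:R * (1 - e) * (q == t)%:R)
  else if (q <= m)%N then
    (p == m.+1)%:R * (q == 1%N)%:R * ent A 1 j
    + (m + k < p)%:R * (q == t)%:R * ent A (p - m) j
  else ent A (p - m) (q - m)
    - (q == m + j)%N%:R * ((p == m.+1)%:R + (m + k < p)%:R) * ent A (p - m) j.

Hypotheses (m0 : (0 < m)%N) (jn : (0 < j <= n)%N) (kn : (0 < k <= n)%N).

(** Since k >= 1, the two indicators subtracted in [Bf] never overlap, so an entry of A at a
    position of E is cancelled exactly once. *)
Lemma lowAE (e : R) (s t p q : nat) : (m < p <= m + n)%N -> (m < q)%N ->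
  lowA A m j k p q = Bf e s t p q.
Proof.
move=> hp hq; rewrite /Bf !ifF; [|lia..].
rewrite /lowA /Defs.inE; have [->|nq] := eqVneq q (m + j)%N; last by rewrite /= mulr0n !mul0r subr0.
rewrite /= mulr1n addKn mul1r; have [->|np] /= := eqVneq p m.+1.
  by rewrite (_ : (m + k < m.+1)%N = false) ?addr0 ?mul1r ?subrr //; lia.
have [kp|kp] := ltnP (m + k)%N p.
  by rewrite (_ : (p <= m + n)%N) ?add0r ?mul1r ?subrr //; lia.
by rewrite addr0 mul0r subr0.
Qed.

(** Compared block by block. As k >= 1, row m + 1 is not among the rows past m + k, and t != s + 1
    keeps (s, t) off the path edge (s, s + 1); hence the sums of indicators in [Bf] agree with the
    first clause of [B2f] that applies. *)
Lemma B2fE (e : R) (s t : nat) : (0 < s < m)%N -> (0 < t <= m)%N -> t != s.+1 ->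
  mx_of (m + n) (B2f A m j k lam e s t) = mx_of (m + n) (Bf e s t).
Proof.
move=> hs ht ts; apply: eq_mx_of => p q hp hq; rewrite /B2f.
have [mp|pm] := ltnP m p; have [mq|qm] /= := ltnP m q.
- by apply: lowAE; lia.
- have [e1 e2 e3] : [/\ (p == m) = false, (p == s) = false & (p < m)%N = false].
    by split; lia.
  have [e4 e5] : (p <= m + n)%N /\ (p <= m)%N = false by lia.
  rewrite /chain /lowcol /Bf e1 e2 e3 e4 e5 qm andbF andbT /=.
  have [->|_] /= := eqVneq p m.+1.
    have -> : (m + k < m.+1)%N = false by lia.
    by case: eqP => _ /=; rewrite ?mulr0n ?mulr1n; ring.
  by case: ltnP => _; case: eqP => _ /=; rewrite ?mulr0n ?mulr1n; ring.
- have [e1 e2] : (q == t) = false /\ (p == m.+1) = false by lia.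
  rewrite /chain /lowcol /Bf /next e1 e2 pm /=.
  have e3 : (m + k < p)%N = false by lia.
  have e4 : (q == p.+1) = (p == m) && (q == m.+1) by lia.
  have e5 : (q == s.+1) = false by lia.
  rewrite e3 e5 !andbF /=.
  have [->|pm'] /= := eqVneq p m.
    have -> : (m == s) = false by lia.
    rewrite ltnn andbF /=; case: eqP => _ /=; rewrite ?mulr0n ?mulr1n; ring.
  have -> : (p < m)%N by lia.
  by rewrite e4 (negPf pm') /= andbF !mulr0n; ring.
- have [e1 e2] : (q == m + j)%N = false /\ (p == m.+1) = false by lia.
  have e3 : (m + k < p)%N = false by lia.
  rewrite /chain /lowcol /Bf /next e1 e2 e3 pm andbF /=.
  have [->|ps] /= := eqVneq p s.
    have -> : (s < m)%N by lia.
    have [->|qs] /= := eqVneq q s.+1.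
      by rewrite eq_sym (negPf ts) !mulr0n; ring.
    by rewrite andbF /=; case: eqP => _ /=; rewrite ?mulr0n ?mulr1n; ring.
  have [p1 p2] : (0 < p)%N /\ (p <= m)%N by lia.
  rewrite p1 /=; case: ltnP => pm' /=; last by rewrite e1 !mulr0n; ring.
  by case: eqP => _ /=; rewrite ?mulr0n ?mulr1n; ring.
Qed.

Lemma B3fE (e : R) (t : nat) : (0 < t <= m)%N ->
  mx_of (m + n) (B3f A m j k lam e t) = mx_of (m + n) (Bf e m t).
Proof.
move=> ht; apply: eq_mx_of => p q hp hq; rewrite /B3f.
have [mp|pm] := ltnP m p; have [mq|qm] /= := ltnP m q.
- by apply: lowAE; lia.
- have [e1 e3] : (p == m) = false /\ (p < m)%N = false by lia.
  have [e4 e5] : (p <= m + n)%N /\ (p <= m)%N = false by lia.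
  rewrite /chain /lowcol /Bf e1 e3 e4 e5 qm andbF andbT /=.
  have [->|_] /= := eqVneq p m.+1.
    have -> : (m + k < m.+1)%N = false by lia.
    by case: eqP => _ /=; rewrite ?mulr0n ?mulr1n; ring.
  by case: ltnP => _; case: eqP => _ /=; rewrite ?mulr0n ?mulr1n; ring.
- have [e1 e2] : (q == t) = false /\ (p == m.+1) = false by lia.
  rewrite /chain /lowcol /Bf /next e1 e2 pm /=.
  have e3 : (m + k < p)%N = false by lia.
  rewrite e3 !andbF /=.
  have [->|pm'] /= := eqVneq p m.
    by rewrite ltnn andbF /=; case: eqP => _ /=; rewrite ?mulr0n ?mulr1n; ring.
  have -> : (p < m)%N by lia.
  have -> : (q == p.+1) = false by lia.
  by rewrite /= andbF !mulr0n; ring.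
- have [e1 e2] : (q == m + j)%N = false /\ (p == m.+1) = false by lia.
  have e3 : (m + k < p)%N = false by lia.
  rewrite /chain /lowcol /Bf /next e1 e2 e3 pm andbF /=.
  have [->|ps] /= := eqVneq p m.
    by rewrite ltnn andbF e1 /=; case: eqP => _ /=; rewrite ?mulr0n ?mulr1n; ring.
  have [p1 p2] : (0 < p)%N /\ (p < m)%N by lia.
  by rewrite p1 p2 /=; case: eqP => _ /=; rewrite ?mulr0n ?mulr1n; ring.
Qed.

Lemma B1fE (t : nat) : (0 < t <= m)%N ->
  mx_of (m + n) (B1f A m j k lam t) = mx_of (m + n) (Bf 1 m t).
Proof.
move=> ht; rewrite -B3fE //; apply: eq_mx_of => p q hp hq; rewrite /B1f /B3f.
rewrite subrr mul0r mul1r; case: ifP => // _.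
(* The definitions differ only in row m: in the order of the clauses and in an entry at (m, t) that
   is 0 for e = 1. *)
have [->|pm] := eqVneq p m; first rewrite /chain /lowcol ltnn andbF /=.
  have [-> ->] : (m == m.+1) = false /\ (m + k < m)%N = false by lia.
  by rewrite /=; case: (q == t); case: ifP.
by [].
Qed.

(** * Right eigenvectors of the bordered matrices *)

Definition weight (e : R) (s p : nat) : R := if p == s then e else 1.

Lemma next_range (p : nat) : (0 < p <= m)%N -> (0 < next p <= m + n)%N.
Proof. by move=> hp; rewrite /next; case: (ltnP p m) => _; lia. Qed.

Lemma row_top (e : R) (s t p : nat) (y : nat -> R) :
  (0 < t <= m)%N -> (0 < p <= m)%N ->
  \sum_(1 <= q < (m + n).+1) Bf e s t p q * y q
  = lam * (weight e s p * y (next p) + (p == s)%:R * (1 - e) * y t).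
Proof.
move=> ht hp; rewrite /Bf (andP hp).2 -/(weight e s p).
under eq_bigr => q _ do rewrite -mulrA mulrDl -!mulrA.
have hn := next_range hp; rewrite -big_distrr big_split -!big_distrr /= !sum_delta.
- by rewrite mulrA.
- by lia.
- by lia.
Qed.

(** Row m + i is row i of A with some entries of column j moved to column 1 or t. Each move
    contributes a difference of values of y, which vanishes once y is constant along the path. *)
Lemma row_bottom (e : R) (s t i : nat) (y : nat -> R) :
  (0 < t <= m)%N -> (0 < i <= n)%N ->
  \sum_(1 <= q < (m + n).+1) Bf e s t (m + i) q * y q
  = \sum_(1 <= q < n.+1) ent A i q * y (m + q)%N
    + (i == 1%N)%:R * ent A 1 j * (y 1%N - y (m + j)%N)
    + (k < i)%:R * ent A i j * (y t - y (m + j)%N).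
Proof.
move=> ht hi; rewrite sum_shift.
have e1 : (m + i == m.+1)%N = (i == 1%N) by lia.
have e2 : (m + k < m + i)%N = (k < i)%N by lia.
have e3 : (m + i <= m)%N = false by lia.
have -> : \sum_(1 <= q < m.+1) Bf e s t (m + i) q * y q
  = (i == 1%N)%:R * ent A 1 j * y 1%N + (k < i)%:R * ent A i j * y t.
  transitivity (\sum_(1 <= q < m.+1)
     ((i == 1%N)%:R * ent A 1 j * ((q == 1%N)%:R * y q)
      + (k < i)%:R * ent A i j * ((q == t)%:R * y q))).
    apply: eq_big_nat => q hq; rewrite /Bf e1 e2 e3 addKn.
    by rewrite (_ : (q <= m)%N); [ring | lia].
  by rewrite big_split -!big_distrr /= !sum_delta //; lia.
have -> : \sum_(1 <= q < n.+1) Bf e s t (m + i) (m + q) * y (m + q)%N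
  = \sum_(1 <= q < n.+1) ent A i q * y (m + q)%N
    - ((i == 1%N)%:R + (k < i)%:R) * ent A i j * y (m + j)%N.
  transitivity (\sum_(1 <= q < n.+1)
     (ent A i q * y (m + q)%N
      - ((i == 1%N)%:R + (k < i)%:R) * ent A i j * ((q == j)%:R * y (m + q)%N))).
    apply: eq_big_nat => q hq; rewrite /Bf e1 e2 e3 !addKn eqn_add2l.
    by rewrite (_ : (m + q <= m)%N = false); [ring | lia].
  by rewrite sumrB -big_distrr /= !(sum_delta (fun q => y (m + q)%N)) //; lia.
have [->|_] := eqVneq i 1%N; last by rewrite !mulr0n; ring.
by rewrite !mulr1n; ring.
Qed.

Lemma const_range (y : nat -> R) (a b : nat) : (a <= b)%N ->
  (forall p, (a <= p < b)%N -> y p = y p.+1) -> y a = y b.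
Proof.
elim: b => [|b IH]; first by rewrite leqn0 => /eqP->.
rewrite leq_eqVlt => /orP[/eqP-> // | ab] h.
rewrite IH; [by apply: h; lia | by [] | by move=> p hp; apply: h; lia].
Qed.

Lemma Bf_rightP (e : R) (s t : nat) (y : nat -> R) :
  e != 0 -> lam != 0 -> (0 < s <= m)%N -> (0 < t <= m)%N -> t != s.+1 ->
  mx_of (m + n) (Bf e s t) *m cv_of (m + n) y = lam *: cv_of (m + n) y <->
  (forall p, (0 < p <= m)%N -> y p = y (m + j)%N) /\
  A *m cv_of n (fun i => y (m + i)%N) = lam *: cv_of n (fun i => y (m + i)%N).
Proof.
move=> e0 l0 hs ht ts.
rewrite -[X in X *m cv_of n _](mx_of_ent A) !mul_mx_cv_of !scale_cv_of -!cv_ofP; split; last first.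
  case=> yc Ay p hp; have [pm|mp] := leqP p m.
    rewrite row_top //; last by lia.
    have -> : y (next p) = y (m + j)%N.
      by rewrite /next; case: ifP => // pm'; apply: yc; lia.
    rewrite (yc t) // (yc p); last by lia.
    by rewrite /weight; case: eqP => _; rewrite ?mulr1n ?mulr0n; ring.
  have [i hi ->] : exists2 i, (0 < i <= n)%N & p = (m + i)%N by exists (p - m)%N; lia.
  rewrite row_bottom // Ay // (yc t) // (yc 1%N); last by lia.
  by rewrite !subrr !mulr0 !addr0.
move=> By.
have top p : (0 < p <= m)%N ->
    weight e s p * y (next p) + (p == s)%:R * (1 - e) * y t = y p.
  move=> hp; apply: (mulfI l0); rewrite -row_top //.
  by apply: By; lia.
have off p : (0 < p <= m)%N -> p != s -> y p = y (next p).
  by move=> hp ps; rewrite -(top p hp) /weight (negPf ps) mulr0n; ring.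
have offS p : (0 < p < m)%N -> p != s -> y p = y p.+1.
  by move=> hp ps; rewrite off // /next ?(andP hp).2 //; lia.
have step p : (0 < p <= m)%N -> y p = y (next p).
  move=> hp; have [ps|] := eqVneq p s; last exact: off.
  have := top p hp; rewrite /weight ps eqxx mulr1n.
  have [t_le_s|s_lt_t] := leqP t s.
    (* For t <= s the rows t, ..., s - 1 give y t = y s, so row s reduces to e (y (next s) - y s) =
       0. *)
    rewrite (@const_range y t s) // => [h|q hq]; last by apply: offS; lia.
    have : e * (y (next s) - y s) = 0 by lra.
    by move/eqP; rewrite mulf_eq0 (negPf e0) subr_eq0 /= => /eqP.
  (* For t >= s + 2 the rows s + 1, ..., t - 1 give y (s + 1) = y t, so the combination in row s has
     a single value. *)
  have sm : (s < m)%N by lia.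
  rewrite /next sm (@const_range y s.+1 t) // => [<-|q hq]; first by ring.
  by apply: offS; lia.
have yc p : (0 < p <= m)%N -> y p = y (m + j)%N.
  move=> hp; rewrite (@const_range y p m); last 2 first.
  - by lia.
  - by move=> q hq; rewrite step /next ?(andP hq).2 //; lia.
  by rewrite step /next ?ltnn //; lia.
split=> // i hi; rewrite -By; last by lia.
by rewrite row_bottom // (yc t) // (yc 1%N) ?subrr ?mulr0 ?addr0 //; lia.
Qed.

(** * Left eigenvectors of the bordered matrices *)

Variables (u v : 'cV[R]_n).

Let alpha := ent A 1 j * ent v 1 1.
Let c := cval A v j k.

Lemma cvalE : \sum_(1 <= i < n.+1) (k < i)%:R * (ent v i 1 * ent A i j) = c - alpha.
Proof.
rewrite /c /cval -/alpha addrC addrA addNr add0r.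
rewrite (sum_tail (fun i => ent A i j * ent v i 1)); last by lia.
by apply: eq_bigr => i _; rewrite [ent v i 1 * _]mulrC.
Qed.

(** Common shape of [wvec] and [zvec]: values on the path, followed by a vector for A. *)
Definition glue (f g : nat -> R) (i : nat) : R := if (i <= m)%N then f i else g (i - m)%N.

(** Inflow at the path vertex q: from its predecessor; at t also from the split edge and the rows
    past m + k ([c - alpha]); at 1 also from row m + 1 ([alpha]). *)
Lemma col_left (e : R) (s t q : nat) (f : nat -> R) :
  (0 < s <= m)%N -> (0 < q <= m)%N ->
  \sum_(1 <= p < (m + n).+1) glue f (fun i => ent v i 1) p * Bf e s t p q
  = (1 < q)%:R * (lam * weight e s q.-1 * f q.-1)
    + (q == t)%:R * (lam * (1 - e) * f s + c - alpha) + (q == 1%N)%:R * alpha.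
Proof.
move=> hs hq; rewrite sum_shift.
have -> : \sum_(1 <= i < n.+1)
     glue f (fun i => ent v i 1) (m + i) * Bf e s t (m + i) q
  = (q == 1%N)%:R * alpha + (q == t)%:R * (c - alpha).
  transitivity (\sum_(1 <= i < n.+1)
     ((q == 1%N)%:R * ent A 1 j * ((i == 1%N)%:R * ent v i 1)
      + (q == t)%:R * ((k < i)%:R * (ent v i 1 * ent A i j)))).
    apply: eq_big_nat => i hi; rewrite /Bf /glue addKn (andP hq).2.
    have -> : (m + i <= m)%N = false by lia.
    have -> : (m + i == m.+1)%N = (i == 1%N) by lia.
    have -> : (m + k < m + i)%N = (k < i)%N by lia.
    by ring.
  rewrite big_split -!big_distrr /= (sum_delta (fun i => ent v i 1)); last by lia.
  by rewrite cvalE /alpha; ring.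
have -> : \sum_(1 <= p < m.+1) glue f (fun i => ent v i 1) p * Bf e s t p q
  = (1 < q)%:R * (lam * weight e s q.-1 * f q.-1) + (q == t)%:R * (lam * (1 - e) * f s).
  transitivity (\sum_(1 <= p < m.+1)
     ((1 < q)%:R * ((p == q.-1)%:R * (lam * weight e s p * f p))
      + (q == t)%:R * (lam * (1 - e)) * ((p == s)%:R * f p))).
    apply: eq_big_nat => p hp; rewrite /Bf /glue -/(weight e s p).
    rewrite (_ : (p <= m)%N); last by lia.
    (* Since j >= 1, [next m] lies beyond m, so q - 1 is the only possible predecessor of q. *)
    have -> : (q == next p) = (1 < q)%N && (p == q.-1).
      by rewrite /next; case: (ltnP p m) => ?; lia.
    by case: (1 < q)%N; rewrite /= ?mulr1n ?mulr0n; ring.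
  rewrite big_split -!big_distrr /= (sum_delta f); last by lia.
  have [q1|q1] := ltnP 1 q; last by rewrite !mulr0n; ring.
  rewrite (sum_delta (fun p => lam * weight e s p * f p)); last by lia.
  by ring.
by ring.
Qed.

(** Only column m + j departs from A: it loses [alpha] and [c - alpha], that is [c] in total, and
    gains the last edge of the path. *)
Lemma col_right (e : R) (s t q : nat) (f : nat -> R) :
  (0 < s <= m)%N -> (0 < t <= m)%N -> (0 < q <= n)%N ->
  \sum_(1 <= p < (m + n).+1) glue f (fun i => ent v i 1) p * Bf e s t p (m + q)
  = \sum_(1 <= i < n.+1) ent v i 1 * ent A i q
    + (q == j)%:R * (lam * weight e s m * f m - c).
Proof.
move=> hs ht hq; rewrite sum_shift.
have -> : \sum_(1 <= i < n.+1)
     glue f (fun i => ent v i 1) (m + i) * Bf e s t (m + i) (m + q)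
  = \sum_(1 <= i < n.+1) ent v i 1 * ent A i q - (q == j)%:R * c.
  transitivity (\sum_(1 <= i < n.+1)
     (ent v i 1 * ent A i q - (q == j)%:R * ((i == 1%N)%:R * (ent v i 1 * ent A i j)
      + (k < i)%:R * (ent v i 1 * ent A i j)))).
    apply: eq_big_nat => i hi; rewrite /Bf /glue !addKn eqn_add2l.
    have -> : (m + i <= m)%N = false by lia.
    have -> : (m + q <= m)%N = false by lia.
    have -> : (m + i == m.+1)%N = (i == 1%N) by lia.
    have -> : (m + k < m + i)%N = (k < i)%N by lia.
    by ring.
  rewrite sumrB -!big_distrr /= big_split /= cvalE.
  rewrite (sum_delta (fun i => ent v i 1 * ent A i j)); last by lia.
  by rewrite /alpha; ring.
have -> : \sum_(1 <= p < m.+1) glue f (fun i => ent v i 1) p * Bf e s t p (m + q)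
  = (q == j)%:R * (lam * weight e s m * f m).
  rewrite -(@sum_delta _ 1 m.+1 m (fun p => (q == j)%:R * (lam * weight e s p * f p)));
    last by lia.
  apply: eq_big_nat => p hp; rewrite /Bf /glue -/(weight e s p).
  rewrite (_ : (p <= m)%N); last by lia.
  have -> : (m + q == t)%N = false by lia.
  have -> : (m + q == next p)%N = (p == m) && (q == j).
    by rewrite /next; case: (ltnP p m) => ?; lia.
  by case: (p == m); rewrite /= ?mulr1n ?mulr0n; ring.
by ring.
Qed.

(** The hypothesis on [f m] says that the last path edge restores the [c] lost by column m + j; the
    recursion is the balance at each path vertex. *)
Lemma Bf_left (e : R) (s t : nat) (f : nat -> R) :
  (0 < s <= m)%N -> (0 < t <= m)%N -> v^T *m A = lam *: v^T ->
  lam * weight e s m * f m = c ->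
  (forall q, (0 < q <= m)%N ->
     (1 < q)%:R * (lam * weight e s q.-1 * f q.-1)
     + (q == t)%:R * (lam * (1 - e) * f s + c - alpha) + (q == 1%N)%:R * alpha
     = lam * f q) ->
  (zvec v m f)^T *m mx_of (m + n) (Bf e s t) = lam *: (zvec v m f)^T.
Proof.
move=> hs ht vA fm frec.
have vq q : (0 < q <= n)%N ->
    \sum_(1 <= i < n.+1) ent v i 1 * ent A i q = lam * ent v q 1.
  move: q; apply/cv_ofP; rewrite -scale_cv_of cv_of_ent.
  apply: trmx_inj; rewrite -mul_cv_mx_of cv_of_ent mx_of_ent vA.
  by apply/matrixP => a b; rewrite !mxE.
rewrite /zvec -/(glue f (fun i => ent v i 1)) mul_cv_mx_of.
rewrite (_ : lam *: _^T = (lam *: cv_of (m + n) (glue f (fun i => ent v i 1)))^T); last first.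
  by apply/matrixP => a b; rewrite !mxE.
rewrite scale_cv_of; congr (_^T); apply/cv_ofP => q hq.
have [qm|mq] := leqP q m.
  by rewrite col_left ?frec /glue ?qm //; lia.
have [i hi ->] : exists2 i, (0 < i <= n)%N & q = (m + i)%N by exists (q - m)%N; lia.
rewrite col_right // vq // fm subrr mulr0 addr0 /glue addKn.
by rewrite (_ : (m + i <= m)%N = false) //; lia.
Qed.

Lemma z2low_last (e : R) (s t : nat) : e != 0 -> lam != 0 ->
  (0 < s <= m)%N -> (0 < t <= m)%N -> t != s.+1 ->
  lam * weight e s m * z2low A v j k lam e s t m = c.
Proof.
move=> e0 l0 hs ht ts; rewrite /z2low /weight -/c.
have [e1 e2] : (m < t)%N = false /\ (m <= s)%N = (m == s) by lia.
rewrite e1 e2; have [t_le_s|s_lt_t] := leqP t s.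
  by case: eqP => _; field; rewrite ?e0 ?l0.
rewrite (_ : (m == s) = false) /=; last by lia.
by field.
Qed.

(** Read lam f(q) as the flow through q. For t <= s, the share 1 - e of the flow c/e at s returns to
    t, where alpha + (c - alpha) + (1 - e) c/e = c/e. For t >= s + 2, that share of alpha skips from
    s to t, leaving e alpha in between, and at t the total e alpha + (1 - e) alpha + (c - alpha) is
    c. *)
Lemma z2low_rec (e : R) (s t q : nat) : e != 0 -> lam != 0 ->
  (0 < s <= m)%N -> (0 < t <= m)%N -> t != s.+1 -> (0 < q <= m)%N ->
  let f := z2low A v j k lam e s t in
  (1 < q)%:R * (lam * weight e s q.-1 * f q.-1)
  + (q == t)%:R * (lam * (1 - e) * f s + c - alpha) + (q == 1%N)%:R * alpha
  = lam * f q.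
Proof.
move=> e0 l0 hs ht ts hq /=; rewrite /z2low /weight -/c -/alpha leqnn.
(* Vertex 1 has no predecessor on the path and receives [alpha] from row m + 1 instead. *)
have e1 : (q == 1%N) = ~~ (1 < q)%N by lia.
have [t_le_s|s_lt_t] := leqP t s.
  have [qt|tq|qt] := ltngtP q t.
  - have -> : (q.-1 < t)%N by lia.
    have -> : (q.-1 == s) = false by lia.
    by rewrite e1; case: (1 < q)%N; rewrite /= ?mulr1n ?mulr0n; field; rewrite ?e0 ?l0.
  - have -> : (q.-1 < t)%N = false by lia.
    have -> : (1 < q)%N by lia.
    have -> : (q == 1%N) = false by lia.
    have -> : (q.-1 <= s)%N = (q <= s)%N || (q.-1 == s) by lia.
    have [qs|sq] := leqP q s.
      rewrite (_ : (q.-1 == s) = false) /= ?mulr1n ?mulr0n; last by lia.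
      by field; rewrite ?e0 ?l0.
    by case: (q.-1 == s); rewrite /= ?mulr1n ?mulr0n; field; rewrite ?e0 ?l0.
  - rewrite qt t_le_s; have [t1|t1] := ltnP 1 t.
      have -> : (t.-1 < t)%N by lia.
      have -> : (t.-1 == s) = false by lia.
      have -> : (t == 1%N) = false by lia.
      by rewrite /= ?mulr1n ?mulr0n; field; rewrite ?e0 ?l0.
    have -> : t = 1%N by lia.
    by rewrite /= ?mulr1n ?mulr0n; field; rewrite ?e0 ?l0.
have [qs|sq] := leqP q s.
  have -> : (q == t) = false by lia.
  have -> : (q.-1 == s) = false by lia.
  have -> : (q.-1 <= s)%N by lia.
  by rewrite e1; case: (1 < q)%N; rewrite /= ?mulr1n ?mulr0n; field; rewrite ?l0.
have q1 : (1 < q)%N by lia.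
rewrite e1 q1 /=; have [->|qs1] := eqVneq q s.+1.
  rewrite /= eqxx leqnn (_ : (s.+1 < t)%N); last by lia.
  rewrite (_ : (s.+1 == t) = false) ?mulr1n ?mulr0n; last by lia.
  by field; rewrite ?l0.
have -> : (q.-1 == s) = false by lia.
have -> : (q.-1 <= s)%N = false by lia.
have [qt|tq|->] := ltngtP q t.
- rewrite (_ : (q.-1 < t)%N) ?mulr1n ?mulr0n; last by lia.
  by field; rewrite ?l0.
- rewrite (_ : (q.-1 < t)%N = false) ?mulr1n ?mulr0n; last by lia.
  by field; rewrite ?l0.
rewrite (_ : (t.-1 < t)%N) ?mulr1n ?mulr0n; last by lia.
by field; rewrite ?l0.
Qed.

(** * Simplicity, positivity and the final quantities *)

Hypotheses (lam0 : 0 < lam) (Au : A *m u = lam *: u) (vA : v^T *m A = lam *: v^T).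
Hypotheses (upos : forall i, 0 < u i 0) (vpos : forall i, 0 < v i 0).
Hypotheses (a1j : 0 < ent A 1 j) (c0 : 0 < c).

Let n0 : (0 < n)%N. Proof. lia. Qed.

Lemma ent_gt0 (y : 'cV[R]_n) (i : nat) :
  (forall p, 0 < y p 0) -> (0 < i <= n)%N -> 0 < ent y i 1.
Proof. by case: i => [|i] //= y0 hi; rewrite (entE y (Ordinal hi) ord0). Qed.

Let alpha0 : 0 < alpha.
Proof. by rewrite mulr_gt0 // ent_gt0. Qed.

Lemma glue_gt0 (f : nat -> R) (y : 'cV[R]_n) :
  (forall p, 0 < f p) -> (forall p, 0 < y p 0) ->
  forall i, 0 < cv_of (m + n) (glue f (fun i => ent y i 1)) i 0.
Proof.
move=> f0 y0 i; rewrite mxE /glue; case: leqP => // mi.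
by apply: ent_gt0 => //; have := ltn_ord i; lia.
Qed.

Lemma z2low_gt0 (e : R) (s t p : nat) : 0 < e -> 0 < z2low A v j k lam e s t p.
Proof.
move=> e0; rewrite /z2low -/alpha -/c.
by repeat case: ifP => _; rewrite divr_gt0 ?mulr_gt0 // ent_gt0.
Qed.

Lemma Bf_eigen (e : R) (s t : nat) : simple_eigenvalue lam A ->
  0 < e -> (0 < s <= m)%N -> (0 < t <= m)%N -> t != s.+1 ->
  let B := mx_of (m + n) (Bf e s t) in
  let w := wvec u m j in
  let z := zvec v m (z2low A v j k lam e s t) in
  [/\ simple_eigenvalue lam B, B *m w = lam *: w,
      z^T *m B = lam *: z^T & alg_positive B].
Proof.
move=> simA e0 hs ht ts B w z.
have [en0 ln0] : e != 0 /\ lam != 0 by rewrite !gt_eqF.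
have N0 : (0 < m + n)%N by lia.
have wR : cv_of n (fun i => if (m + i <= m)%N then ent u j 1 else ent u (m + i - m) 1) = u.
  by rewrite -[RHS]cv_of_ent; apply/cv_ofP => p hp; rewrite addKn ifF //; lia.
have Bw : B *m w = lam *: w.
  apply/Bf_rightP => //; split; last by rewrite wR.
  by move=> p hp; rewrite addKn (andP hp).2 ifF //; lia.
have zB : z^T *m B = lam *: z^T.
  by apply: Bf_left => //; [exact: z2low_last | move=> q hq; exact: z2low_rec].
have w0 : forall i, 0 < w i 0 by apply: glue_gt0 => // p; apply: ent_gt0.
have z0 : forall i, 0 < z i 0 by apply: glue_gt0 => // p; apply: z2low_gt0.
have sB : simple_eigenvalue lam B.
  apply/(pos_simple_eigenvalueP N0 ln0 Bw zB w0 z0) => y.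
  rewrite -(cv_of_ent y); set Y := fun p => ent y p 1.
  move/(Bf_rightP _ en0 ln0 hs ht ts) => [Yc AY] zy.
  set y' := cv_of n _ in AY.
  (* This b makes v^T (y' - b u) = 0, so the simplicity of lam for A forces y' = b u. *)
  pose b := (v^T *m y') 0 0 / (v^T *m u) 0 0.
  have y'E : y' = b *: u.
    apply/eqP; rewrite -subr_eq0; apply/eqP.
    apply: (pos_simple_eigenvalueP n0 ln0 Au vA upos vpos).1 => //.
      by rewrite mulmxBr AY -scalemxAr Au scalerBr scalerA mulrC -scalerA.
    rewrite mulmxBr -scalemxAr [v^T *m u]mx11_scalar scale_scalar_mx.
    by rewrite /b divfK ?gt_eqF ?pairing_gt0 // -mx11_scalar subrr.
  have YE p : (0 < p <= n)%N -> Y (m + p)%N = b * ent u p 1.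
    by move: p; apply/cv_ofP; rewrite -scale_cv_of cv_of_ent.
  have yE : cv_of (m + n) Y = b *: w.
    rewrite scale_cv_of; apply/cv_ofP => p hp; have [pm|mp] := leqP p m.
      by rewrite Yc ?YE //; lia.
    have [i hi ->] : exists2 i, (0 < i <= n)%N & p = (m + i)%N by exists (p - m)%N; lia.
    by rewrite YE // addKn.
  (* Now z^T y = b z^T w with z^T w > 0, hence b = 0. *)
  move: zy; rewrite yE -scalemxAr => /matrixP/(_ 0 0); rewrite [LHS]mxE [RHS]mxE => /eqP.
  rewrite mulf_eq0 (gt_eqF (pairing_gt0 N0 w0 z0)) orbF => /eqP->.
  by rewrite scale0r.
split=> //; exact: (simple_alg_positive N0 ln0 Bw zB w0 z0 sB).
Qed.

(** The rows past m + k give [c - alpha]; the split entry adds (1 - e) lam z_s, which is (1 - e) c/e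
    when t <= s and (1 - e) alpha otherwise. *)
Lemma qtyE (e : R) (s t : nat) : 0 < e ->
  (0 < s <= m)%N -> (0 < t <= m)%N -> t != s.+1 ->
  qty (mx_of (m + n) (Bf e s t)) (zvec v m (z2low A v j k lam e s t)) m n k s t
  = if (t <= s)%N then c / e - alpha else c - e * alpha.
Proof.
move=> e0 hs ht ts; have [en0 ln0] : e != 0 /\ lam != 0 by rewrite !gt_eqF.
rewrite /qty ent_mx_of ?ent_cv_of; [|lia..].
rewrite (andP hs).2.
have -> : \sum_(1 <= i < (n - k).+1) ent (mx_of (m + n) (Bf e s t)) (m + k + i) t *
    ent (zvec v m (z2low A v j k lam e s t)) (m + k + i) 1 = c - alpha.
  rewrite -cvalE -(sum_tail (fun i => ent v i 1 * ent A i j)); last by lia.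
  apply: eq_big_nat => i hi; rewrite ent_mx_of ?ent_cv_of; [|lia..].
  have e1 : (m + (k + i) <= m)%N = false by lia.
  rewrite /Bf -addnA addKn e1.
  rewrite (andP ht).2 eqxx (_ : (m + (k + i) == m.+1)%N = false); last by lia.
  by rewrite (_ : (m + k < m + (k + i))%N) ?mulr1n ?mulr0n; [ring | lia].
rewrite /Bf (andP hs).2 !eqxx /z2low leqnn -/c -/alpha.
have -> : (t == next s) = false by rewrite /next; case: (ltnP s m) => ?; lia.
have [st|st] := leqP t s; rewrite ?mulr1n ?mulr0n.
  by field; rewrite en0 ln0.
by field.
Qed.

Lemma qty_gt0 (s t : nat) : (0 < s <= m)%N -> (0 < t <= m)%N -> t != s.+1 ->
  exists e : R, 0 < e < 1 /\
    0 < qty (mx_of (m + n) (Bf e s t)) (zvec v m (z2low A v j k lam e s t)) m n k s t.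
Proof.
(* One e serves both cases: c/e - alpha becomes c, and c - e alpha becomes c e. *)
move=> hs ht ts; exists (c / (c + alpha)).
have d0 : 0 < c + alpha by rewrite addr_gt0.
have e0 : 0 < c / (c + alpha) by rewrite divr_gt0.
split; first by rewrite e0 ltr_pdivrMr // mul1r ltrDl.
rewrite qtyE //; case: ifP => _.
  by rewrite (_ : _ - _ = c) //; field; rewrite !gt_eqF.
rewrite (_ : _ - _ = c * (c / (c + alpha))); first exact: mulr_gt0.
by field; rewrite gt_eqF.
Qed.

Lemma z3vecE (e : R) (t : nat) : (0 < t <= m)%N ->
  zvec v m (z3low A v j k lam e t) = zvec v m (z2low A v j k lam e m t).
Proof.
move=> ht; apply/cv_ofP => p hp; case: ifP => // pm.
by rewrite /z3low /z2low pm (andP ht).2.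
Qed.

Lemma z1vecE (t : nat) : (0 < t <= m)%N ->
  zvec v m (z1low A v j k lam t) = zvec v m (z2low A v j k lam 1 m t).
Proof.
by move=> ht; rewrite -z3vecE //; apply/cv_ofP => p hp; rewrite /z3low mul1r.
Qed.

End Border.

Set Strict Implicit.
Unset Implicit Arguments.

Theorem theorem2p5 (R : realType) (n m : nat) (A : 'M[R]_n) (j k : nat)
    (lam eps : R) (u v : 'cV[R]_n) :
  0 < eps < 1 -> (0 < n)%N -> (0 < m)%N ->
  (1 <= j <= n)%N -> 0 < ent A 1 j ->
  0 < lam -> simple_eigenvalue lam A ->
  A *m u = lam *: u -> v^T *m A = lam *: v^T ->
  (forall i, 0 < u i 0) -> (forall i, 0 < v i 0) ->
  (1 <= k <= n)%N -> 0 < cval A v j k ->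
  [/\
   (* Part 1 *)
   (forall s : nat, (1 <= s <= m)%N ->
     let B := mx_of (m + n) (B1f A m j k lam s) in
     let w := wvec u m j in
     let z := zvec v m (z1low A v j k lam s) in
     [/\ simple_eigenvalue lam B, B *m w = lam *: w,
         z^T *m B = lam *: z^T & alg_positive B]),
   (* Part 2 *)
   (forall s t : nat, (1 <= s)%N -> (s < m)%N -> (1 <= t <= m)%N ->
     t <> s.+1 ->
     let B := mx_of (m + n) (B2f A m j k lam eps s t) in
     let w := wvec u m j in
     let z := zvec v m (z2low A v j k lam eps s t) in
     [/\ simple_eigenvalue lam B, B *m w = lam *: w,
         z^T *m B = lam *: z^T, alg_positive B &
         (qty B z m n k s t =
           (if (t <= s)%N then cval A v j k / eps - ent A 1 j * ent v 1 1
            else cval A v j k - eps * (ent A 1 j * ent v 1 1)) /\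
         exists e : R, 0 < e < 1 /\
           0 < qty (mx_of (m + n) (B2f A m j k lam e s t))
                   (zvec v m (z2low A v j k lam e s t)) m n k s t)]) &
   (* Part 3 *)
   (forall t : nat, (1 <= t <= m)%N ->
     let B := mx_of (m + n) (B3f A m j k lam eps t) in
     let w := wvec u m j in
     let z := zvec v m (z3low A v j k lam eps t) in
     [/\ simple_eigenvalue lam B, B *m w = lam *: w,
         z^T *m B = lam *: z^T, alg_positive B &
         (qty B z m n k m t = cval A v j k / eps - ent A 1 j * ent v 1 1 /\
         exists e : R, 0 < e < 1 /\
           0 < qty (mx_of (m + n) (B3f A m j k lam e t))
                   (zvec v m (z3low A v j k lam e t)) m n k m t)])].

Proof.
move=> /andP[e0 e1] n0 m0 jn a1j lam0 simA Au vA upos vpos kn c0.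
(* Part 1 is the instance (1, m, s) of [Bf_eigen], part 2 is (eps, s, t) and part 3 is (eps, m,
   t). *)
have main e s t := @Bf_eigen _ _ _ _ _ _ lam m0 jn kn u v lam0 Au vA upos vpos a1j c0 e s t simA.
split.
- move=> s hs; rewrite B1fE // z1vecE //.
  by apply: main => //; lia.
- move=> s t s1 sm ht /eqP ts; have hs : (0 < s <= m)%N by lia.
  have hs' : (0 < s < m)%N by lia.
  cbv zeta; rewrite B2fE //.
  have [h1 h2 h3 h4] := main eps s t e0 hs ht ts; split=> //.
  rewrite qtyE //; split=> //.
  have [e [he he0]] := qty_gt0 m0 jn kn lam0 vpos a1j c0 hs ht ts.
  by exists e; split=> //; rewrite B2fE.
- move=> t ht; have hm : (0 < m <= m)%N by lia.
  have tm : t != m.+1 by lia.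
  cbv zeta; rewrite B3fE // z3vecE //.
  have [h1 h2 h3 h4] := main eps m t e0 hm ht tm; split=> //.
  rewrite qtyE // (andP ht).2; split=> //.
  have [e [he he0]] := qty_gt0 m0 jn kn lam0 vpos a1j c0 hm ht tm.
  by exists e; split=> //; rewrite B3fE // z3vecE.
Qed.
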